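(* Let $\lambda>0$, $\xi>0$, $v_2<v_1$ with either $v_2<0<v_1$ or $0<v_2<v_1$, and let $\tilde X(t)$ be the position of the extended telegraph process driven by GCPs with parameter $\lambda$ with Poissonian resets to the origin at rate $\xi$, started at $\tilde X(0)=0$, $V(0)=v_j$. For $j=1,2$, $t>0$ and $v_2t<x<v_1t$, the (generalized) density $\tilde p(x,t|v_j)=\tilde p_1(x,t|v_j)+\tilde p_2(x,t|v_j)$ and the flow function $\tilde w(x,t|v_j)=\tilde p_1(x,t|v_j)-\tilde p_2(x,t|v_j)$ are $$ \tilde p(x,t|v_j)=\frac{e^{-\xi t}\delta(x-v_jt)}{1+\lambda t}+\mathrm{sgn}(v_j)\mathbb 1_{\{0<\frac{x}{v_j}<t\}}\frac{\xi e^{-\xi x/v_j}}{v_j+\lambda x}+\mathbb 1_{\{v_2t<x<v_1t\}}\frac{e^{-\xi t}\lambda}{(v_1-v_2)(1+\lambda t)}+\boldsymbol I(x,t)\frac{\xi e^{\xi/\lambda}}{v_1-v_2}\Gamma_\lambda^\xi(x,t), $$ $$ \begin{aligned} \tilde w(x,t|v_j)&=(-1)^{j-1}\frac{e^{-\xi t}\delta(x-v_jt)}{1+\lambda t}+\mathbb 1_{\{v_2t<x<v_1t\}}\frac{\lambda e^{-\xi t}[\lambda(2\tau-t)+(-1)^j]}{(v_1-v_2)(1+\lambda t)^2}+\mathrm{sgn}(v_j)(-1)^{j-1}\mathbb 1_{\{0<\frac{x}{v_j}<t\}}\frac{\xi e^{-\xi x/v_j}}{v_j+\lambda x}\\ &\quad+\boldsymbol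 I(x,t)\Bigg\{\frac{2\xi(v_{3-j}+\lambda x)}{(v_1-v_2)^2}\Theta_\lambda^\xi(x,t)-\frac{\xi e^{\xi/\lambda}}{(v_1-v_2)^2}\Big[2v_{3-j}\xi\Big(\frac{x}{v_{3-j}}+\frac1\lambda\Big)+(v_1+v_2)\Big]\Gamma_\lambda^\xi(x,t)\Bigg\}. \end{aligned} $$
   Context: Geometric counting process (GCP) with intensity $\lambda>0$: a counting process $\tilde N_\lambda$ with $\tilde N_\lambda(0)=0$ obtained as a Poisson process whose rate is random and exponentially distributed with mean $\lambda$; its increments satisfy $P\{\tilde N_\lambda(t+s)-\tilde N_\lambda(t)=k\}=\frac{1}{1+\lambda s}\big(\frac{\lambda s}{1+\lambda s}\big)^k$, and each inter-event time has marginal density $\lambda/(1+\lambda t)^2$. Process without resets $(X(t),V(t))$: starts at $X(0)=0$ with $V(0)=v_j$ ($v_1,v_2\ne0$, $v_2<v_1$), velocity alternates between $v_1$ and $v_2$, $X(t)=\int_0^tV(s)ds$, with the periods spent at velocity $v_1$ and at $v_2$ governed by two independent GCPs of intensity $\lambda$. Its generalized sub-densities $p_i(x,t|v_j)=P[X(t)\in dx,V(t)=v_i|X(0)=0,V(0)=v_j]/dx$ are $p_i(x,t|v_j)=\mathbb 1_{\{i=j\}}\frac{\delta(x-v_jt)}{1+\lambda t}+\mathbb 1_{\{v_2t<x<v_1t\}}\frac{\lambda c_{i,j}}{(v_1-v_2)(1+\lambda t)^2}$ with $c_{1,1}=\lambda\tau$, $c_{1,2}=1+\lambda\tau$, $c_{2,1}=1+\lambda(t-\tau)$,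 $c_{2,2}=\lambda(t-\tau)$, $\tau=\tau(x,t)=\frac{x-v_2t}{v_1-v_2}$. Reset process $(\tilde X(t),V(t))$: same dynamics but instantaneously reset to the origin at the epochs of an independent Poisson process of rate $\xi$, restarting afresh with velocity $v_j$; its sub-densities $\tilde p_i(x,t|v_j)\,dx=P[\tilde X(t)\in dx,V(t)=v_i|\tilde X(0)=0,V(0)=v_j]$ satisfy $\tilde p_i(x,t|v_j)=e^{-\xi t}p_i(x,t|v_j)+\xi\int_0^te^{-\xi s}p_i(x,s|v_j)ds$. $\delta$ is the Dirac delta. Notation: $M_x=\max\{x/v_1,x/v_2\}$, $m_{x,t}=\min\{x/v_2,t\}$; $\Gamma(a,z_0,z_1)=\int_{z_0}^{z_1}s^{a-1}e^{-s}ds$; $\Gamma_\lambda^\xi(x,t)=\Gamma[0,(M_x+\frac1\lambda)\xi,(t+\frac1\lambda)\xi]$ if $v_2<0<v_1$, $=\Gamma[0,(\frac x{v_1}+\frac1\lambda)\xi,(m_{x,t}+\frac1\lambda)\xi]$ if $0<v_2<v_1$; $\boldsymbol I(x,t)=\mathbb 1_{\{\min\{v_2t,0\}<x<v_1t\}}$; $\Theta_\lambda^\xi(x,t)=\frac{e^{-\xi M_x}}{1+\lambda M_x}-\frac{e^{-\xi t}}{1+\lambda t}$ if $v_2<0<v_1$, $=\frac{e^{-\xi x/v_1}}{1+\lambda x/v_1}-\frac{e^{-\xi m_{x,t}}}{1+\lambda m_{x,t}}$ if $0<v_2<v_1$. *)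

(* Defs.v *)
From HB Require Import structures.
From mathcomp Require Import all_boot all_order all_algebra.
From mathcomp Require Import all_classical all_reals all_analysis.
Set Implicit Arguments. Unset Strict Implicit. Unset Printing Implicit Defensive.
Import Order.TTheory GRing.Theory Num.Theory.
Local Open Scope classical_set_scope.
Local Open Scope ring_scope.

Section GCPTelegraph.
Variable R : realType.
Variables (lam xi v1 v2 : R).

Definition vel (j : nat) : R := if j == 1%N then v1 else v2.

Definition tau (x t : R) : R := (x - v2 * t) / (v1 - v2).

Definition cij (i j : nat) (x t : R) : R :=
  if i == 1%N then (if j == 1%N then lam * tau x t else 1 + lam * tau x t)
  else (if j == 1%N then 1 + lam * (t - tau x t) else lam * (t - tau x t)).

Definition p_ac (i j : nat) (t x : R) : R :=
  if (v2 * t < x) && (x < v1 * t)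
  then lam * cij i j x t / ((v1 - v2) * (1 + lam * t) ^+ 2) else 0.

(* The generalized sub-density p_i(.,t|v_j), viewed as the (sub-probability)
   measure it defines:  P_i(t|v_j)(A) = \int_A p_i(x,t|v_j) dx, the Dirac part
   1_{i=j} delta(x - v_j t)/(1+lam t) contributing 1_A(v_j t)/(1+lam t). *)
Definition P_meas (i j : nat) (t : R) (A : set R) : R :=
  (if i == j then \1_A (vel j * t) / (1 + lam * t) else 0)
  + Rintegral lebesgue_measure A (p_ac i j t).

(* The reset process: p~_i = e^{-xi t} p_i + xi \int_0^t e^{-xi s} p_i(.,s) ds,
   again as measures (integrated over a Borel set A). *)
Definition Pt_meas (i j : nat) (t : R) (A : set R) : R :=
  expR (- xi * t) * P_meas i j t A
  + xi * Rintegral lebesgue_measure `[0, t]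
                   (fun s => expR (- xi * s) * P_meas i j s A).

Definition GammaInc (a z0 z1 : R) : R :=
  Rintegral lebesgue_measure `[z0, z1] (fun s => s `^ (a - 1) * expR (- s)).

Definition Mx (x : R) : R := Num.max (x / v1) (x / v2).
Definition mxt (x t : R) : R := Num.min (x / v2) t.

Definition GammaLX (x t : R) : R :=
  if v2 < 0 then GammaInc 0 ((Mx x + 1 / lam) * xi) ((t + 1 / lam) * xi)
  else GammaInc 0 ((x / v1 + 1 / lam) * xi) ((mxt x t + 1 / lam) * xi).

Definition ThetaLX (x t : R) : R :=
  if v2 < 0 then
    expR (- xi * Mx x) / (1 + lam * Mx x) - expR (- xi * t) / (1 + lam * t)
  else
    expR (- xi * (x / v1)) / (1 + lam * (x / v1))
    - expR (- xi * mxt x t) / (1 + lam * mxt x t).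

Definition Ind (x t : R) : R :=
  if (Num.min (v2 * t) 0 < x) && (x < v1 * t) then 1 else 0.

Definition ind_strip (x t : R) : R :=
  if (v2 * t < x) && (x < v1 * t) then 1 else 0.

Definition ind_pos (j : nat) (x t : R) : R :=
  if (0 < x / vel j) && (x / vel j < t) then 1 else 0.

(* non-Dirac part of p~(x,t|v_j) *)
Definition dens_p (j : nat) (t x : R) : R :=
  Num.sg (vel j) * ind_pos j x t * (xi * expR (- xi * x / vel j) / (vel j + lam * x))
  + ind_strip x t * (expR (- xi * t) * lam / ((v1 - v2) * (1 + lam * t)))
  + Ind x t * (xi * expR (xi / lam) / (v1 - v2) * GammaLX x t).

(* non-Dirac part of w~(x,t|v_j) *)
Definition dens_w (j : nat) (t x : R) : R :=
  ind_strip x t *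
    (lam * expR (- xi * t) * (lam * (2 * tau x t - t) + (-1) ^+ j)
     / ((v1 - v2) * (1 + lam * t) ^+ 2))
  + Num.sg (vel j) * (-1) ^+ j.-1 * ind_pos j x t
      * (xi * expR (- xi * x / vel j) / (vel j + lam * x))
  + Ind x t *
    (2 * xi * (vel (3 - j) + lam * x) / (v1 - v2) ^+ 2 * ThetaLX x t
     - xi * expR (xi / lam) / (v1 - v2) ^+ 2
       * (2 * vel (3 - j) * xi * (x / vel (3 - j) + 1 / lam) + (v1 + v2))
       * GammaLX x t).

End GCPTelegraph.

(* Main.v *)
Require Import Defs.
From HB Require Import structures.
From mathcomp Require Import all_boot all_order all_algebra.
From mathcomp Require Import all_classical all_reals all_analysis.
From mathcomp Require Import measurable_realfun ring lra.
Import Order.TTheory GRing.Theory Num.Theory.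
Import numFieldNormedType.Exports.
Local Open Scope classical_set_scope.
Local Open Scope ring_scope.

(* Integrating over a Borel set A, Fubini turns the time integral defining
   p~_i into a spatial density.  The travelling atom at v_j s contributes, by the
   substitution x = v_j s, the term in e^(-xi x / v_j) / (v_j + lam x).  For the
   absolutely continuous part, x lies in the strip v2 s < x < v1 s (with s < t)
   exactly when s > a, for an entry time a = a(x), and c_ij is affine in
   1 + lam s; so only the integrals over [a, t] of e^(-xi s) / (1 + lam s) and
   e^(-xi s) / (1 + lam s)^2 occur.  The first one is an incomplete Gamma
   function, and integration by parts reduces the second one to Theta and the
   first. *)

(** * Measurability of inverses *)

Lemma measurable_invr (R : realType) :
  measurable_fun [set: R] (fun x : R => x^-1).
Proof.
(* Since [0^-1 = 0], inversion is glued from a constant at the point [0] and a continuous map on its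
   open complement. *)
rewrite [X in measurable_fun _ X](_ : _ =
  fun x : R => if x == 0 then 0 else x^-1); last first.
  by apply/funext => x; case: eqP => // ->; rewrite invr0.
apply: measurable_fun_if => //.
- exact: measurable_fun_eqr.
- rewrite [X in measurable_fun X _](_ : _ = [set x : R | x != 0]); last first.
    apply/seteqP; split => x /=; rewrite ?setTI //=.
      by case=> _ /negbT.
    by move=> /negbTE ->.
  apply: open_continuous_measurable_fun; first exact: open_neq.
  by move=> x; rewrite inE /=; exact: inv_continuous.
Qed.

Lemma measurable_funV d (T : measurableType d) (R : realType) (D : set T)
    (f : T -> R) : measurable_fun D f -> measurable_fun D (fun x => (f x)^-1).
Proof. by move=> mf; exact: (measurableT_comp (measurable_invr R)). Qed.

(** * Affine change of variables for Lebesgue measure *)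

Section lebesgue.
Context {R : realType}.
Notation mu := (@lebesgue_measure R).

Lemma affine_measurable (a b : R) :
  measurable_fun setT (fun s => a * s + b : measurableTypeR R).
Proof. by apply: measurable_funD => //; apply: measurable_funM. Qed.

Lemma affine_preimage_itvoc (a b c d : R) : a != 0 ->
  (fun s => a * s + b) @^-1` `]c, d] =
  if 0 < a then `](c - b) / a, (d - b) / a]%classic
  else `[(d - b) / a, (c - b) / a[%classic.
Proof.
move=> a0; apply/seteqP; split => s /=; case: ifPn => a_s /=; rewrite !in_itv/=.
- by rewrite ltr_pdivrMr// ler_pdivlMr// ltrBlDr lerBrDr mulrC.
- have an : a < 0 by rewrite lt_neqAle a0 leNgt.
  by rewrite ltr_ndivlMr// ler_ndivrMr// ltrBlDr lerBrDr mulrC andbC.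
- by rewrite ltr_pdivrMr// ler_pdivlMr// ltrBlDr lerBrDr mulrC.
- have an : a < 0 by rewrite lt_neqAle a0 leNgt.
  by rewrite ltr_ndivlMr// ler_ndivrMr// ltrBlDr lerBrDr mulrC andbC.
Qed.

(** The factor [|a|] compensates the dilation, so that Lebesgue measure is recovered when
    [a != 0]. *)
Definition affine_image (a b : R) : {measure set (measurableTypeR R) -> \bar R} :=
  mscale (NngNum (normr_ge0 a))
    (measure_function_pushforward__canonical__measure_function_Measure
       mu (affine_measurable a b)).

(** Lebesgue measure is determined by its values on the intervals []c, d]], whose preimages are
    intervals of length [(d - c) / |a|]. *)
Lemma lebesgue_measure_affine (a b : R) (A : set R) : a != 0 -> measurable A ->
  mu A = affine_image a b A.
Proof.
move=> a0 mA.
apply: lebesgue_measure_unique => //=.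
move=> _ [[c d]] _ <-.
rewrite /affine_image /mscale /= /pushforward affine_preimage_itvoc//.
case: ifPn => a_s.
  rewrite !lebesgue_measure_itv/= !lte_fin ltr_pM2r ?invr_gt0// ltrD2r.
  case: ifP => cd; last by rewrite mule0.
  by rewrite -EFinB -EFinM gtr0_norm//; congr EFin; field.
have an : a < 0 by rewrite lt_neqAle a0 leNgt.
rewrite !lebesgue_measure_itv/= !lte_fin ltr_nM2r ?invr_lt0// ltrD2r.
case: ifP => cd; last by rewrite mule0.
by rewrite -EFinB -EFinM ltr0_norm//; congr EFin; field.
Qed.

Lemma Rintegral_affine (a b : R) (D : set R) (f : R -> R) :
  a != 0 -> measurable D -> measurable_fun D f -> (forall x, D x -> 0 <= f x) ->
  Rintegral mu D f =
  `|a| * Rintegral mu ((fun s => a * s + b) @^-1` D) (fun s => f (a * s + b)).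
Proof.
move=> a0 mD mf f0.
have ma := affine_measurable a b.
rewrite /Rintegral (eq_measure_integral (affine_image a b)); last first.
  by move=> A mA _; exact: lebesgue_measure_affine.
rewrite ge0_integral_mscale//; last exact/measurable_EFinP.
rewrite ge0_integral_pushforward//; last 2 first.
- exact/measurable_EFinP.
- by move=> x /set_mem /f0.
(* [f] may fail to be integrable: [fine] then sends the infinite integrals on both sides to [0]. *)
rewrite /=; case: integral => [r //||]; rewrite /= mulr0.
  by rewrite gt0_muley// lte_fin normr_gt0.
by rewrite gt0_muleNy// lte_fin normr_gt0.
Qed.

End lebesgue.

(** * Integrability of bounded functions and Fubini's theorem *)

Lemma bounded_integrable d (T : measurableType d) (R : realType)
    (m : {measure set T -> \bar R})
    (D : set T) (f : T -> R) (C : R) :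
  measurable D -> (m D < +oo)%E -> measurable_fun D f ->
  (forall x, D x -> `|f x| <= C) -> m.-integrable D (EFin \o f).
Proof.
move=> mD Dfin mf fC; apply: measurable_bounded_integrable => //.
exists C; split; first exact: num_real.
by move=> M CM x Dx /=; rewrite (le_trans (fC _ Dx))// ltW.
Qed.

(** Cut off to the rectangle [A * B] of finite measure, the bounded [f] is integrable for the
    product measure. Its sections are integrable as well, so the real-valued inner integrals are the
    genuine ones and not default values of [fine]. *)
Lemma Fubini_bounded d1 d2 (T1 : measurableType d1) (T2 : measurableType d2)
    (R : realType) (m1 : {sigma_finite_measure set T1 -> \bar R})
    (m2 : {sigma_finite_measure set T2 -> \bar R})
    (A : set T1) (B : set T2) (f : T1 -> T2 -> R) (C : R) :
  measurable A -> measurable B -> (m1 A < +oo)%E -> (m2 B < +oo)%E ->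
  measurable_fun setT (fun z : T1 * T2 => f z.1 z.2) ->
  (forall x s, A x -> B s -> `|f x s| <= C) ->
  [/\ m1.-integrable A (EFin \o fun x => Rintegral m2 B (f x)),
      m2.-integrable B (EFin \o fun s => Rintegral m1 A (f ^~ s)) &
      Rintegral m2 B (fun s => Rintegral m1 A (f ^~ s)) =
      Rintegral m1 A (fun x => Rintegral m2 B (f x))].
Proof.
move=> mA mB Afin Bfin mf fC.
pose F := (fun z : T1 * T2 => (f z.1 z.2)%:E) \_ (A `*` B).
have mAB : measurable (A `*` B) by exact: measurableX.
have iF : (m1 \x m2)%E.-integrable setT F.
  apply: (integrable_mkcond _ mAB).1.
  apply: (@bounded_integrable _ _ _ _ _ (fun z : T1 * T2 => f z.1 z.2) C) => //.
  - by rewrite [ltLHS]product_measure1E// lte_mul_pinfty// ge0_fin_numE.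
  - exact: measurable_funTS.
  - by move=> [x s] [/= ? ?]; exact: fC.
have FA : (fun x => \int[m2]_s F (x, s))%E =
    (EFin \o fun x => Rintegral m2 B (f x)) \_ A.
  apply/funext => x; rewrite [RHS]patchE; case: ifPn => xA; last first.
    by apply: integral0_eq => s _; rewrite /F patchE in_setX (negbTE xA).
  transitivity (\int[m2]_(s in B) (f x s)%:E)%E.
    rewrite [RHS]integral_mkcond; apply: eq_integral => s _.
    by rewrite /F !patchE in_setX xA.
  rewrite /= fineK//; apply: integrable_fin_num => //.
  apply: (@bounded_integrable _ _ _ _ _ (f x) C) => //.
    apply: measurable_funTS.
    exact: (measurableT_comp mf (pair1_measurable x)).
  by move=> s; apply: fC; exact: set_mem.
have FB : (fun s => \int[m1]_x F (x, s))%E =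
    (EFin \o fun s => Rintegral m1 A (f ^~ s)) \_ B.
  apply/funext => s; rewrite [RHS]patchE; case: ifPn => sB; last first.
    by apply: integral0_eq => x _; rewrite /F patchE in_setX (negbTE sB) andbF.
  transitivity (\int[m1]_(x in A) (f x s)%:E)%E.
    rewrite [RHS]integral_mkcond; apply: eq_integral => x _.
    by rewrite /F !patchE in_setX sB andbT.
  rewrite /= fineK//; apply: integrable_fin_num => //.
  apply: (@bounded_integrable _ _ _ _ _ (f ^~ s) C) => //.
    apply: measurable_funTS.
    exact: (measurableT_comp mf (pair2_measurable s)).
  by move=> x Ax; apply: fC => //; exact: set_mem.
split.
- by apply: (integrable_mkcond _ mA).2; rewrite -FA; exact: integrable_fubini_F.
(* The inner integrals are bounded by [C * m1 A], and the product-measure theory supplies their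
   measurability. *)
- apply: (@bounded_integrable _ _ _ _ _ _ (C * fine (m1 A))) => //.
    apply/measurable_EFinP/(measurable_restrictT _ mB).2; rewrite -FB.
    exact: (measurable_fubini_G iF).
  move=> s Bs.
  have ifs : m1.-integrable A (EFin \o f ^~ s).
    apply: (@bounded_integrable _ _ _ _ _ (f ^~ s) C) => //.
      apply: measurable_funTS.
      exact: (measurableT_comp mf (pair2_measurable s)).
    by move=> x Ax; exact: fC.
  rewrite (le_trans (le_normr_Rintegral mA ifs))// -Rintegral_cst//.
  apply: le_Rintegral => //; first exact: integrable_norm.
    by apply: (@bounded_integrable _ _ _ _ _ _ `|C|).
  by move=> x Ax; exact: fC.
- rewrite /Rintegral -/(EFin \o _).
  by rewrite [in LHS]integral_mkcond [in RHS]integral_mkcond -FA -FB (Fubini iF).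
Qed.

Lemma lebesgue_measure_lty (R : realType) (a b : R) (D : set R) :
  measurable D -> D `<=` `[a, b] -> (@lebesgue_measure R D < +oo)%E.
Proof.
move=> mD Dab.
apply: (@le_lt_trans _ _ (@lebesgue_measure R `[a, b])).
  by apply: le_measure => //; rewrite inE.
by rewrite lebesgue_measure_itv /=; case: ifPn => //; rewrite -EFinB ltry.
Qed.

(** * Survival functions and their time integrals *)

Definition reset_survival {R : realType} (xi s : R) : R := expR (- xi * s).

(** Probability that a GCP has no event during a time [s]: the case [k = 0] of the law of its
    increments. *)
Definition gcp_survival {R : realType} (lam s : R) : R := (1 + lam * s)^-1.

Section integrals.
Context {R : realType} (lam xi : R) (hlam : 0 < lam) (hxi : 0 < xi).
Notation mu := (@lebesgue_measure R).

Local Notation e := (reset_survival xi).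
Local Notation q := (gcp_survival lam).

Lemma is_derive_reset_survival (s : R) : is_derive s 1 e (- xi * e s).
Proof.
rewrite /reset_survival.
apply: is_derive_eq.
by rewrite /GRing.scale /= mulr1 mulrC.
Qed.

Lemma gcp_rate_gt0 (s : R) : 0 <= s -> 0 < 1 + lam * s.
Proof. by move=> s0; rewrite ltr_pwDl// mulr_ge0// ltW. Qed.

Lemma is_derive_gcp_survival (s : R) : 0 <= s -> is_derive s 1 q (- lam * q s ^+ 2).
Proof.
move=> s0; have q0 := gcp_rate_gt0 _ s0; rewrite /gcp_survival.
have h : 1 + lam * s != 0 by rewrite gt_eqF.
have H : is_derive s 1 (fun s : R => 1 + lam * s) lam.
  apply: is_derive_eq; rewrite /GRing.scale /= add0r; ring.
have ? := is_deriveV (f := fun s : R => 1 + lam * s) h H.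
by apply: is_derive_eq; rewrite /GRing.scale /= exprVn; ring.
Qed.

Lemma gcp_survival_le1 (s : R) : 0 <= s -> q s <= 1.
Proof. by move=> s0; rewrite invf_le1 ?gcp_rate_gt0// lerDl mulr_ge0// ltW. Qed.

Lemma gcp_survival_ge0 (s : R) : 0 <= s -> 0 <= q s.
Proof. by move=> s0; rewrite invr_ge0 ltW// gcp_rate_gt0. Qed.

Lemma reset_survival_le1 (s : R) : 0 <= s -> e s <= 1.
Proof.
move=> s0; rewrite /reset_survival -expR0 ler_expR mulNr oppr_le0.
by rewrite mulr_ge0// ltW.
Qed.

Lemma measurable_reset_survival : measurable_fun setT e.
Proof.
by apply: measurableT_comp => //; apply: measurable_funM.
Qed.

Lemma measurable_gcp_survival : measurable_fun setT q.
Proof.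
by apply: measurable_funV; apply: measurable_funD => //; apply: measurable_funM.
Qed.

Lemma measurable_survival n : measurable_fun setT (fun s => e s * q s ^+ n).
Proof.
apply: measurable_funM; first exact: measurable_reset_survival.
by apply: measurable_funX; exact: measurable_gcp_survival.
Qed.

Lemma survival_ge0 n (s : R) : 0 <= s -> 0 <= e s * q s ^+ n.
Proof. by move=> s0; rewrite mulr_ge0// ?expR_ge0 ?exprn_ge0 ?gcp_survival_ge0. Qed.

Lemma survival_le1 n (s : R) : 0 <= s -> e s * q s ^+ n <= 1.
Proof.
move=> s0.
rewrite mulr_ile1 ?expR_ge0 ?exprn_ge0 ?gcp_survival_ge0 ?reset_survival_le1//.
by rewrite exprn_ile1 ?gcp_survival_ge0 ?gcp_survival_le1.
Qed.

Lemma integrable_survival n (D : set R) (t : R) : measurable D -> D `<=` `[0, t] ->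
  mu.-integrable D (EFin \o fun s => e s * q s ^+ n).
Proof.
move=> mD Dt; apply: (@bounded_integrable _ _ _ _ _ _ 1) => //.
- exact: lebesgue_measure_lty Dt.
- apply: measurable_funTS; exact: measurable_survival.
- move=> s /Dt /=; rewrite in_itv /= => /andP[s0 _].
  by rewrite ger0_norm ?survival_ge0// survival_le1.
Qed.

(** Substitute [z = xi * s + xi / lam] in the integral of [e^(-z) / z]: as
    [z = (xi / lam) * (1 + lam * s)], the inverse of [z] yields [q s], and the shift yields the
    factor [e^(-xi / lam)]. *)
Lemma GammaInc_survival (a t : R) : 0 <= a -> a <= t ->
  GammaInc 0 ((a + 1 / lam) * xi) ((t + 1 / lam) * xi) =
  lam * expR (- (xi / lam)) * Rintegral mu `[a, t] (fun s => e s * q s ^+ 1).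
Proof.
move=> a0 at_; have l0 : lam != 0 by rewrite gt_eqF.
have x0 : xi != 0 by rewrite gt_eqF.
rewrite /GammaInc (Rintegral_affine xi (xi / lam))//; first last.
- by move=> x _; rewrite mulr_ge0// ?powR_ge0 ?expR_ge0.
- apply: measurable_funTS; apply: measurable_funM.
    exact: measurable_powR.
  by apply: measurableT_comp => //; exact: measurableT_comp.
rewrite (_ : _ @^-1` _ = `[a, t]%classic); last first.
  apply/seteqP; split => s /=; rewrite !in_itv /= => /andP[h1 h2]; apply/andP;
    split.
  + by rewrite -(ler_pM2r hxi) -(lerD2r (1 / lam * xi)); lra.
  + by rewrite -(ler_pM2r hxi) -(lerD2r (1 / lam * xi)); lra.
  + by have := ler_wpM2r (ltW hxi) h1; lra.
  + by have := ler_wpM2r (ltW hxi) h2; lra.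
have ie : mu.-integrable `[a, t] (EFin \o fun s => e s * q s ^+ 1).
  apply: (@integrable_survival _ _ t) => // s /=; rewrite !in_itv /= => /andP[h ->].
  by rewrite (le_trans a0).
transitivity (xi * Rintegral mu `[a, t]
    (fun s => lam * expR (- (xi / lam)) / xi * (e s * q s ^+ 1))).
  rewrite gtr0_norm//; congr (_ * _); apply: eq_Rintegral => s.
  rewrite inE /= in_itv /= => /andP[h _].
  have q0 := gcp_rate_gt0 s (le_trans a0 h).
  rewrite sub0r powR_inv1; last first.
    by rewrite addr_ge0 ?divr_ge0 ?mulr_ge0 ?(le_trans a0 h) ?ltW.
  rewrite opprD expRD /reset_survival /gcp_survival mulNr expr1.
  field; rewrite x0 l0 (gt_eqF q0) /=.
  rewrite (_ : _ + _ = xi * (1 + lam * s)); last by ring.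
  by rewrite gt_eqF// mulr_gt0.
rewrite RintegralZl// mulrA; congr (_ * _).
by field.
Qed.

Lemma Rintegral_survival_sqr (a t : R) : 0 <= a -> a < t ->
  Rintegral mu `[a, t] (fun s => e s * q s ^+ 2) =
  (e a * q a - e t * q t) / lam
  - xi / lam * Rintegral mu `[a, t] (fun s => e s * q s ^+ 1).
Proof.
move=> a0 at_; have l0 : lam != 0 by rewrite gt_eqF.
have sub : `[a, t] `<=` `[0, t].
  move=> s /=; rewrite !in_itv /= => /andP[h ->].
  by rewrite (le_trans a0).
have ie n : mu.-integrable `[a, t] (EFin \o fun s => e s * q s ^+ n).
  exact: (@integrable_survival _ _ t).
(* This derivative contains both integrands, so the fundamental theorem of calculus on [[a, t]]
   gives a linear relation between the two integrals. *)
have dF (s : R) : 0 <= s -> is_derive s 1 (fun s => - (e s * q s))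
    (xi * (e s * q s ^+ 1) + lam * (e s * q s ^+ 2)).
  move=> s0; have ? := is_derive_reset_survival s.
  have ? := is_derive_gcp_survival s s0.
  by apply: is_derive_eq; rewrite /GRing.scale /=; ring.
have cF (s : R) : 0 <= s -> {for s, continuous (fun s => - (e s * q s))}.
  move=> s0; apply/differentiable_continuous/derivable1_diffP.
  by case: (dF s s0).
have H : Rintegral mu `[a, t]
    (fun s => xi * (e s * q s ^+ 1) + lam * (e s * q s ^+ 2)) =
    - (e t * q t) - - (e a * q a).
  rewrite /Rintegral (continuous_FTC2 (F := fun s => - (e s * q s)))//.
  - apply: derivable_within_continuous => s; rewrite in_itv /= => /andP[h _].
    have s0 := le_trans a0 h.
    have ? := is_derive_reset_survival s.
    have ? := is_derive_gcp_survival s s0.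
    by apply: derivableD; do 2 apply: derivableM => //; apply: derivableX.
  - split.
    + move=> s; rewrite in_itv /= => /andP[h _].
      by case: (dF s (le_trans a0 (ltW h))).
    + by apply: cvg_at_right_filter; exact: cF.
    + by apply: cvg_at_left_filter; apply: cF; rewrite (le_trans a0)// ltW.
  - move=> s; rewrite in_itv /= => /andP[h _]; rewrite derive1E.
    by have ? := dF s (le_trans a0 (ltW h)); rewrite derive_val.
move: H; rewrite RintegralD//; last 2 first.
- exact: (integrableZl _ xi (ie 1%N)).
- exact: (integrableZl _ lam (ie 2%N)).
rewrite !RintegralZl// => H.
apply: (mulfI l0); rewrite [LHS](_ : _ = - (e t * q t) - - (e a * q a)
  - xi * Rintegral mu `[a, t] (fun s => e s * q s ^+ 1)); last first.
  by rewrite -H; ring.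
by field.
Qed.

End integrals.

Lemma Rintegral_itv_oo_cc (R : realType) (a b : R) (f : R -> R) :
  (@lebesgue_measure R).-integrable `[a, b] (EFin \o f) ->
  Rintegral lebesgue_measure `[a, b] f = Rintegral lebesgue_measure `]a, b[ f.
Proof.
move=> intf.
rewrite -Rintegral_itv_obnd_cbnd; last first.
  by apply: integrableS intf => //; exact: subset_itv_oc_cc.
rewrite -Rintegral_itv_bndo_bndc//.
by apply: integrableS intf => //; exact: subset_itv_oo_cc.
Qed.

(** * Entry time into the strip and bounds on the sub-densities *)

Section process.
Context {R : realType} {lam xi v1 v2 : R}.
Context (hlam : 0 < lam) (hxi : 0 < xi) (hv : v2 < v1).
Context (hcase : (v2 < 0 /\ 0 < v1) \/ (0 < v2 /\ v2 < v1)).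
Notation mu := (@lebesgue_measure R).
Local Notation e := (reset_survival xi).
Local Notation q := (gcp_survival lam).

(* [a] is the time at which the strip (v2 s, v1 s) reaches x; when 0 < v2 the
   strip never leaves x before t, because v2 t <= x. *)
Lemma strip_entry_time (t x : R) : 0 < t -> v2 * t <= x -> x <= v1 * t ->
  exists2 a, 0 <= a &
  [/\ Ind v1 v2 x t = (if a < t then 1 else 0),
      GammaLX lam xi v1 v2 x t =
        GammaInc 0 ((a + 1 / lam) * xi) ((t + 1 / lam) * xi),
      ThetaLX lam xi v1 v2 x t = e a * q a - e t * q t &
      forall s, s < t -> (v2 * s < x) && (x < v1 * s) = (a < s)].
Proof.
move=> t0 xl xr.
case: hcase => -[v20 v10].
  (* With velocities of opposite signs, both strip inequalities are lower bounds on [s]; the entry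
     time is the larger one. *)
  exists (Mx v1 v2 x).
    rewrite /Mx le_max; case: (leP 0 x) => x0.
      by rewrite divr_ge0// ltW.
    by rewrite orbC mulr_le0// ?invr_le0 ltW.
  have H s : (v2 * s < x) && (x < v1 * s) = (Mx v1 v2 x < s).
    rewrite /Mx gt_max ltr_pdivrMr// ltr_ndivrMr// andbC.
    by rewrite (mulrC s v1) (mulrC s v2).
  split=> [|||s _]; last exact: H.
  - rewrite /Ind (_ : Num.min _ _ = v2 * t) ?H//.
    by apply/min_idPl; rewrite nmulr_rle0// ltW.
  - by rewrite /GammaLX v20.
  - by rewrite /ThetaLX v20.
have v1p : 0 < v1 by rewrite (lt_trans v20).
have x0 : 0 < x by rewrite (lt_le_trans _ xl)// mulr_gt0.
have v2n : (v2 < 0) = false by apply/negbTE; rewrite -leNgt ltW.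
(* Since [v2 * t <= x], the exit time [x / v2] is at least [t], so [t] is the upper end in both
   special functions. *)
have mt : mxt v2 x t = t.
  by apply/min_idPr; rewrite ler_pdivlMr// mulrC.
exists (x / v1); first by rewrite divr_ge0// ltW.
split.
- rewrite /Ind (_ : Num.min _ _ = 0).
    by rewrite x0 /= ltr_pdivrMr// mulrC.
  by apply/min_idPr; rewrite mulr_ge0// ltW.
- by rewrite /GammaLX v2n mt.
- by rewrite /ThetaLX v2n mt.
- move=> s st; rewrite ltr_pdivrMr// (mulrC s) andb_idl// => _.
  by rewrite (lt_le_trans _ xl)// ltr_pM2l.
Qed.

(** Expanding in [1 + lam * s] separates the indices: up to the sign, the constant term depends on
    [j] and the slope on [i]. Against the weight [q s ^+ 2], the constant term keeps [q s ^+ 2] and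
    the slope term leaves [q s]. *)
Lemma cijE (i j : nat) (x s : R) : i = 1%N \/ i = 2%N -> j = 1%N \/ j = 2%N ->
  cij lam v1 v2 i j x s =
  (-1) ^+ i.-1 * ((lam * x + vel v1 v2 (3 - j)) / (v1 - v2)
                  - vel v1 v2 (3 - i) / (v1 - v2) * (1 + lam * s)).
Proof.
have d0 : v1 - v2 != 0 by rewrite gt_eqF// subr_gt0.
by move=> [->|->] [->|->]; rewrite /cij /vel /tau /=; field.
Qed.

(** [tau] is the time spent at velocity [v1], so inside the strip it lies between [0] and [s]. The
    bound is uniform in [x] and [s], as Fubini requires. *)
Lemma cij_bound (i j : nat) (x s t : R) :
  0 <= s -> s <= t -> v2 * s < x -> x < v1 * s ->
  0 <= cij lam v1 v2 i j x s <= 1 + lam * t.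
Proof.
move=> s0 st xl xr.
have d0 : 0 < v1 - v2 by rewrite subr_gt0.
have t1 : 0 <= tau v1 v2 x s by rewrite divr_ge0 ?ltW// subr_gt0.
have t2 : tau v1 v2 x s <= s by rewrite ler_pdivrMr//; lra.
have lt1 : 0 <= lam * tau v1 v2 x s by rewrite mulr_ge0// ltW.
have lt2 : 0 <= lam * (s - tau v1 v2 x s) by rewrite mulr_ge0// ?subr_ge0// ltW.
have lst : lam * s <= lam * t by rewrite ler_pM2l.
rewrite /cij; move: (tau v1 v2 x s) lt1 lt2 {t1 t2} => T lt1 lt2.
by do 2 (case: ifP => _); apply/andP; split; lra.
Qed.

Lemma p_acE (i j : nat) (x s : R) : p_ac lam v1 v2 i j s x =
  if (v2 * s < x) && (x < v1 * s)
  then lam * cij lam v1 v2 i j x s / (v1 - v2) * q s ^+ 2 else 0.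
Proof.
rewrite /p_ac /gcp_survival; case: ifP => // _.
by rewrite invfM exprVn mulrA.
Qed.

Lemma p_ac_bound (i j : nat) (x s t : R) : 0 <= s -> s <= t ->
  `|p_ac lam v1 v2 i j s x| <= lam * (1 + lam * t) / (v1 - v2).
Proof.
move=> s0 st; have d0 : 0 < v1 - v2 by rewrite subr_gt0.
have t1 : 0 <= 1 + lam * t by rewrite addr_ge0// mulr_ge0 ?(le_trans s0 st)// ltW.
rewrite p_acE; case: ifP => [/andP[xl xr]|_]; last first.
  by rewrite normr0 divr_ge0 ?mulr_ge0// ltW.
have /andP[c0 c1] := cij_bound i j _ _ _ s0 st xl xr.
have k0 : 0 <= lam * cij lam v1 v2 i j x s / (v1 - v2).
  by rewrite divr_ge0 ?mulr_ge0// ltW.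
rewrite ger0_norm; last by rewrite mulr_ge0// exprn_ge0// gcp_survival_ge0//.
apply: (@le_trans _ _ (lam * cij lam v1 v2 i j x s / (v1 - v2))).
  by rewrite ler_piMr// exprn_ile1// ?gcp_survival_ge0 ?gcp_survival_le1//.
by rewrite ler_pM2r ?invr_gt0// ler_pM2l.
Qed.

Lemma measurable_damped_p_ac (i j : nat) :
  measurable_fun setT (fun z : R * R => e z.2 * p_ac lam v1 v2 i j z.2 z.1).
Proof.
have mx : measurable_fun setT (fun z : R * R => z.1) by exact: measurable_fst.
have ms : measurable_fun setT (fun z : R * R => z.2) by exact: measurable_snd.
apply: measurable_funM.
  exact: (measurableT_comp (measurable_reset_survival xi) ms).
rewrite [X in measurable_fun _ X](_ : _ = fun z : R * R =>
  if (v2 * z.2 < z.1) && (z.1 < v1 * z.2)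
  then lam * cij lam v1 v2 i j z.1 z.2 / (v1 - v2) * q z.2 ^+ 2 else 0); last first.
  by apply/funext => z; rewrite p_acE.
have mtau : measurable_fun setT (fun z : R * R => tau v1 v2 z.1 z.2).
  apply: measurable_funM => //; apply: measurable_funB => //.
  exact: measurable_funM.
apply: measurable_fun_ifT => //.
  apply: measurable_and; apply: measurable_fun_ltr => //; exact: measurable_funM.
apply: measurable_funM; last first.
  apply: measurable_funX.
  exact: (measurableT_comp (measurable_gcp_survival lam) ms).
apply: measurable_funM => //; apply: measurable_funM => //.
rewrite /cij; case: (i == 1%N); case: (j == 1%N).
- exact: measurable_funM.
- by apply: measurable_funD => //; exact: measurable_funM.
- apply: measurable_funD => //; apply: measurable_funM => //.
  exact: measurable_funB.
- by apply: measurable_funM => //; exact: measurable_funB.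
Qed.

(** * The travelling atom *)

Lemma measurable_indic_scale (v : R) (A : set R) : measurable A ->
  measurable_fun setT (fun s : R => \1_A (v * s) : R).
Proof.
move=> mA; apply: (measurableT_comp (measurable_indic mA)).
exact: measurable_funM.
Qed.

Lemma measurable_atom (v : R) (A : set R) : measurable A ->
  measurable_fun setT (fun s => e s * q s ^+ 1 * \1_A (v * s)).
Proof.
move=> mA; apply: measurable_funM; first exact: measurable_survival.
exact: measurable_indic_scale.
Qed.

Lemma atom_bound (v : R) (A : set R) (s : R) : 0 <= s ->
  0 <= e s * q s ^+ 1 * \1_A (v * s) <= 1.
Proof.
move=> s0; rewrite indicE; have := survival_ge0 lam xi hlam 1 s s0.
have := survival_le1 lam xi hlam hxi 1 s s0.
by case: (_ \in _) => /=; rewrite ?mulr1 ?mulr0 ?lexx ?ler01// => -> ->.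
Qed.

Lemma integrable_atom (v t : R) (A : set R) : measurable A ->
  mu.-integrable `[0, t] (EFin \o fun s => e s * q s ^+ 1 * \1_A (v * s)).
Proof.
move=> mA; apply: (@bounded_integrable _ _ _ _ _ _ 1) => //.
- exact: (@lebesgue_measure_lty _ 0 t).
- by apply: measurable_funTS; exact: measurable_atom.
- move=> s /=; rewrite in_itv /= => /andP[s0 _].
  by have /andP[h1 h2] := atom_bound v A s s0; rewrite ger0_norm.
Qed.

(* Image under s |-> v s of the damped mass e^(-xi s) / (1 + lam s) ds carried
   by the atom on [0, t]. *)
Definition atom_dens (v t x : R) : R :=
  Num.sg v * (if (0 < x / v) && (x / v < t) then 1 else 0)
  * (expR (- xi * x / v) / (v + lam * x)).

(** Factoring [v + lam * x = v * (1 + lam * (x / v))] leaves [sg v / v], the absolute Jacobian of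
    [s = x / v]; this is where the sign of the velocity comes from. *)
Lemma atom_densE (v t x : R) : v != 0 -> atom_dens v t x =
  if (0 < x / v) && (x / v < t) then `|v^-1| * (e (x / v) * q (x / v) ^+ 1)
  else 0.
Proof.
move=> v0; rewrite /atom_dens; case: ifP => [/andP[h1 h2]|_]; last first.
  by rewrite mulr0 mul0r.
have q0 := gcp_rate_gt0 lam hlam _ (ltW h1).
rewrite mulr1 normrEsg sgrV /reset_survival /gcp_survival expr1 -(mulrA _ x).
have vx : v + lam * x = v * (1 + lam * (x / v)) by field.
by rewrite vx; field; rewrite v0 vx mulf_neq0// gt_eqF.
Qed.

Lemma measurable_atom_dens (v t : R) : measurable_fun setT (atom_dens v t).
Proof.
rewrite /atom_dens; apply: measurable_funM.
  apply: measurable_funM; first by [].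
  apply: measurable_fun_ifT => //.
  by apply: measurable_and; apply: measurable_fun_ltr => //; exact: measurable_funM.
apply: measurable_funM.
  by apply: measurableT_comp => //; apply: measurable_funM.
by apply: measurable_funV; apply: measurable_funD => //; exact: measurable_funM.
Qed.

Lemma integrable_atom_dens (v t : R) (A : set R) : v != 0 -> measurable A ->
  (mu A < +oo)%E -> mu.-integrable A (EFin \o atom_dens v t).
Proof.
move=> v0 mA Afin; apply: (@bounded_integrable _ _ _ _ _ _ `|v^-1|) => //.
  by apply: measurable_funTS; exact: measurable_atom_dens.
move=> x _; rewrite atom_densE//; case: ifP => [/andP[/ltW h _]|_]; last first.
  by rewrite normr0.
by rewrite normrM normr_id ler_piMr// ger0_norm ?survival_ge0 ?survival_le1.
Qed.

Lemma Rintegral_atom (v t : R) (A : set R) : v != 0 -> measurable A ->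
  Rintegral mu `[0, t] (fun s => e s * q s ^+ 1 * \1_A (v * s)) =
  Rintegral mu A (atom_dens v t).
Proof.
(* Dropping the null endpoints matches the strict inequalities in [atom_dens]. *)
move=> v0 mA; rewrite Rintegral_itv_oo_cc; last exact: integrable_atom.
rewrite (Rintegral_affine v^-1 0)//; first last.
- move=> s /=; rewrite in_itv /= => /andP[s0 _].
  by case/andP: (atom_bound v A s (ltW s0)).
- by apply: measurable_funTS; exact: measurable_atom.
- by rewrite invr_eq0.
have mP : measurable [set x | 0 < x / v < t].
  have mg : measurable_fun setT (fun x : R => x / v) by exact: measurable_funM.
  rewrite (_ : mkset _ = setT `&` (fun x => x / v) @^-1` `]0, t[); last first.
    by rewrite setTI; apply/seteqP; split=> x /=; rewrite in_itv.
  exact: mg.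
set P := _ @^-1` _.
have PE : P = [set x | 0 < x / v < t].
  by apply/seteqP; split=> x; rewrite /P /= in_itv /= addr0 mulrC.
have Pt : P `<=` `[- (`|v| * t), `|v| * t].
  move=> x; rewrite PE /= in_itv /= -ler_norml => /andP[h1 h2].
  rewrite -(divfK v0 x) normrM mulrC ler_pM2l ?normr_gt0//.
  by rewrite gtr0_norm// ltW.
have mf : measurable_fun setT (fun x : R => e (v^-1 * x + 0) * q (v^-1 * x + 0) ^+ 1
    * \1_A (v * (v^-1 * x + 0))).
  apply: (measurableT_comp (f := fun s => e s * q s ^+ 1 * \1_A (v * s))).
    exact: measurable_atom.
  by apply: measurable_funD => //; exact: measurable_funM.
rewrite -RintegralZl; [|by rewrite PE|]; last first.
  apply: (@bounded_integrable _ _ _ _ _ _ 1).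
  - by rewrite PE.
  - by apply: lebesgue_measure_lty Pt; rewrite PE.
  - exact: measurable_funTS.
  - move=> x; rewrite PE /= => /andP[h1 _].
    have s0 : 0 <= v^-1 * x + 0 by rewrite addr0 mulrC ltW.
    by have /andP[? ?] := atom_bound v A _ s0; rewrite ger0_norm.
(* Over the whole line the two sets trade places: on the left [P] is the domain and [A] an indicator
   in the integrand, on the right the reverse. *)
rewrite [LHS]Rintegral_mkcond [RHS]Rintegral_mkcond; apply: eq_Rintegral => x _.
rewrite !patchE PE addr0 (mulrC v^-1) (mulrC v (x / v)) divfK//.
rewrite -/(atom_dens v t x) atom_densE//.
rewrite indicE; case: (x \in A); last by rewrite !mulr0; case: ifP.
rewrite mulr1; case: ifPn => [/set_mem /= ->//|].
by case: ifPn => // h; rewrite mem_set.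
Qed.

(** * Time integral of the absolutely continuous part *)

Lemma measurable_damped_p_ac_time (i j : nat) (x : R) :
  measurable_fun setT (fun s => e s * p_ac lam v1 v2 i j s x).
Proof.
exact: (measurableT_comp (measurable_damped_p_ac i j) (pair1_measurable x)).
Qed.

Lemma damped_p_ac_bound (i j : nat) (x s t : R) : 0 <= s -> s <= t ->
  `|e s * p_ac lam v1 v2 i j s x| <= lam * (1 + lam * t) / (v1 - v2).
Proof.
move=> s0 st; rewrite normrM (ger0_norm (expR_ge0 _)) -[leRHS]mul1r.
by rewrite ler_pM ?normr_ge0 ?expR_ge0 ?reset_survival_le1 ?p_ac_bound.
Qed.

Lemma Rintegral_damped_p_ac (i j : nat) (t x a : R) :
  i = 1%N \/ i = 2%N -> j = 1%N \/ j = 2%N -> 0 <= a ->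
  (forall s, s < t -> (v2 * s < x) && (x < v1 * s) = (a < s)) ->
  Rintegral mu `[0, t] (fun s => e s * p_ac lam v1 v2 i j s x) =
  if a < t then (-1) ^+ i.-1 * lam / (v1 - v2) ^+ 2 *
    ((lam * x + vel v1 v2 (3 - j))
      * Rintegral mu `[a, t] (fun s => e s * q s ^+ 2)
     - vel v1 v2 (3 - i) * Rintegral mu `[a, t] (fun s => e s * q s ^+ 1))
  else 0.
Proof.
move=> hi hj a0 hs; have d0 : v1 - v2 != 0 by rewrite gt_eqF// subr_gt0.
(* The endpoint [s = t] has to go, because [hs] describes the strip only for [s < t]. *)
rewrite [LHS]Rintegral_itv_oo_cc; last first.
  apply: (@bounded_integrable _ _ _ _ _ _ (lam * (1 + lam * t) / (v1 - v2))) => //.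
  - exact: (@lebesgue_measure_lty _ 0 t).
  - by apply: measurable_funTS; exact: measurable_damped_p_ac_time.
  - by move=> s /=; rewrite in_itv /= => /andP[? ?]; exact: damped_p_ac_bound.
(* These are the coefficients of [e s * q s ^+ 2] and [e s * q s] once [cijE] is inserted and
   [q s ^+ 2 * (1 + lam * s) = q s] is used. *)
set c2 := (-1) ^+ i.-1 * lam / (v1 - v2) ^+ 2 * (lam * x + vel v1 v2 (3 - j)).
set c1 := (-1) ^+ i.-1 * lam / (v1 - v2) ^+ 2 * - vel v1 v2 (3 - i).
transitivity (Rintegral mu (`]0, t[ `&` `]a, +oo[)
    (fun s => c2 * (e s * q s ^+ 2) + c1 * (e s * q s ^+ 1))).
  rewrite Rintegral_mkcondr; apply: eq_Rintegral => s.
  rewrite inE /= in_itv /= => /andP[s0 st].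
  rewrite patchE p_acE hs//; case: ifPn => as_; last first.
    by rewrite memNset ?mulr0//= in_itv /= andbT; exact/negP.
  rewrite mem_set /= ?in_itv /= ?as_// cijE//.
  have q0 := gcp_rate_gt0 lam hlam s (ltW s0).
  have qs : q s * (1 + lam * s) = 1 by rewrite mulVf// gt_eqF.
  have -> : q s ^+ 1 = q s ^+ 2 * (1 + lam * s).
    by rewrite expr1 expr2 -mulrA qs mulr1.
  rewrite /c1 /c2; set Q := q s ^+ 2.
  by field.
case: ifPn => at_; last first.
  rewrite (_ : _ `&` _ = set0) ?Rintegral_set0//.
  apply/seteqP; split => // s [] /=; rewrite !in_itv /= andbT => /andP[_ st] as_.
  by rewrite (lt_trans as_ st) in at_.
rewrite (_ : _ `&` _ = `]a, t[%classic); last first.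
  apply/seteqP; split => s /=; rewrite !in_itv /= andbT.
    by move=> [/andP[_ ->] ->].
  by move=> /andP[as_ ->]; rewrite as_ (le_lt_trans a0 as_).
have sub : `[a, t] `<=` `[0, t].
  move=> s /=; rewrite !in_itv /= => /andP[h ->].
  by rewrite (le_trans a0).
have ie n : mu.-integrable `[a, t] (EFin \o fun s => e s * q s ^+ n).
  exact: (@integrable_survival _ lam xi hlam hxi n _ t).
have ieo n : mu.-integrable `]a, t[ (EFin \o fun s => e s * q s ^+ n).
  by apply: integrableS (ie n) => //; exact: subset_itv_oo_cc.
rewrite RintegralD//; last 2 first.
- exact: (integrableZl _ c2 (ieo 2%N)).
- exact: (integrableZl _ c1 (ieo 1%N)).
rewrite !RintegralZl// -!Rintegral_itv_oo_cc// /c1 /c2.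
by ring.
Qed.

(** * Densities of the reset process *)

(** Non-Dirac part of the reset sub-density before simplification: paths without reset, then paths
    whose last reset lies a time [s] back, split into moving atom and continuous part. *)
Definition reset_dens (i j : nat) (t x : R) : R :=
  e t * p_ac lam v1 v2 i j t x
  + (if i == j then xi * atom_dens (vel v1 v2 j) t x else 0)
  + xi * Rintegral mu `[0, t] (fun s => e s * p_ac lam v1 v2 i j s x).

Lemma vel_neq0 (j : nat) : vel v1 v2 j != 0.
Proof.
rewrite /vel; case: ifP => _; case: hcase => -[h1 h2].
- by rewrite gt_eqF.
- by rewrite gt_eqF// (lt_trans h1).
- by rewrite lt_eqF.
- by rewrite gt_eqF.
Qed.

Lemma integrable_p_ac (i j : nat) (s : R) (A : set R) : 0 <= s ->
  measurable A -> (mu A < +oo)%E ->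
  mu.-integrable A (EFin \o p_ac lam v1 v2 i j s).
Proof.
move=> s0 mA Afin.
apply: (@bounded_integrable _ _ _ _ _ _ (lam * (1 + lam * s) / (v1 - v2))) => //.
  (* Measurability is inherited from the damped density, by dividing by the positive constant
     [e s]. *)
  rewrite (_ : p_ac _ _ _ _ _ _ = fun x => (e s)^-1 *
    (e s * p_ac lam v1 v2 i j s x)); last first.
    by apply/funext => x; rewrite mulKf// gt_eqF// expR_gt0.
  apply: measurable_funTS; apply: measurable_funM => //.
  exact: (measurableT_comp (measurable_damped_p_ac i j) (pair2_measurable s)).
by move=> x Ax; exact: p_ac_bound.
Qed.

Lemma damped_P_measE (i j : nat) (s : R) (A : set R) : 0 <= s ->
  measurable A -> (mu A < +oo)%E ->
  e s * P_meas lam v1 v2 i j s A =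
  (if i == j then e s * q s ^+ 1 * \1_A (vel v1 v2 j * s) else 0)
  + Rintegral mu A (fun x => e s * p_ac lam v1 v2 i j s x).
Proof.
move=> s0 mA Afin; rewrite RintegralZl//; last exact: integrable_p_ac.
rewrite /P_meas mulrDr; congr (_ + _).
by case: ifP => _; rewrite ?mulr0// expr1 -mulrA (mulrC (q s)).
Qed.

(** Fubini applies thanks to the uniform bound on the damped density and the finite measure of [A].
    The integrability it yields allows later sums to be split. *)
Lemma Rintegral_damped_P_meas (i j : nat) (t : R) (A : set R) :
  measurable A -> (mu A < +oo)%E ->
  mu.-integrable A (EFin \o fun x =>
    Rintegral mu `[0, t] (fun s => e s * p_ac lam v1 v2 i j s x)) /\
  Rintegral mu `[0, t] (fun s => e s * P_meas lam v1 v2 i j s A) =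
  (if i == j then Rintegral mu A (atom_dens (vel v1 v2 j) t) else 0)
  + Rintegral mu A (fun x =>
      Rintegral mu `[0, t] (fun s => e s * p_ac lam v1 v2 i j s x)).
Proof.
move=> mA Afin.
have Tfin : (mu `[0%R, t]%classic < +oo)%E by exact: (@lebesgue_measure_lty _ 0 t).
pose C := lam * (1 + lam * t) / (v1 - v2).
have bnd (x s : R) : A x -> `[0, t]%classic s ->
    `|e s * p_ac lam v1 v2 i j s x| <= C.
  by move=> _ /=; rewrite in_itv /= => /andP[? ?]; exact: damped_p_ac_bound.
have [iA iT <-] := @Fubini_bounded _ _ _ _ R mu mu A `[0, t]
  (fun x s => e s * p_ac lam v1 v2 i j s x) C mA (measurable_itv _) Afin Tfin
  (measurable_damped_p_ac i j) bnd.
split=> [|{iA}]; first exact: iA.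
transitivity (Rintegral mu `[0, t] (fun s =>
    (if i == j then e s * q s ^+ 1 * \1_A (vel v1 v2 j * s) else 0)
    + Rintegral mu A (fun x => e s * p_ac lam v1 v2 i j s x))).
  apply: eq_Rintegral => s; rewrite inE /= in_itv /= => /andP[s0 _].
  exact: damped_P_measE.
case: (i == j).
  rewrite RintegralD//; last exact: integrable_atom.
  by rewrite Rintegral_atom ?vel_neq0.
by rewrite add0r; apply: eq_Rintegral => s _; rewrite add0r.
Qed.

(** Lying in a bounded interval, [A] has finite measure; each term of [reset_dens] is then
    integrable over it, and the integral splits term by term. *)
Lemma Pt_measE (i j : nat) (t : R) (A : set R) : 0 < t ->
  measurable A -> A `<=` `[v2 * t, v1 * t] ->
  mu.-integrable A (EFin \o reset_dens i j t) /\
  Pt_meas lam xi v1 v2 i j t A =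
  (if i == j then e t * \1_A (vel v1 v2 j * t) / (1 + lam * t) else 0)
  + Rintegral mu A (reset_dens i j t).
Proof.
move=> t0 mA At.
have Afin := lebesgue_measure_lty _ _ _ _ mA At.
have iat : mu.-integrable A (EFin \o atom_dens (vel v1 v2 j) t).
  by apply: integrable_atom_dens => //; exact: vel_neq0.
have iat' : mu.-integrable A (EFin \o (fun x =>
    if i == j then xi * atom_dens (vel v1 v2 j) t x else 0)).
  case: (i == j); first exact: (integrableZl _ xi iat).
  by apply: (@bounded_integrable _ _ _ _ _ _ 0) => // x _; rewrite normr0.
have ip := integrable_p_ac i j _ _ (ltW t0) mA Afin.
have iep : mu.-integrable A (EFin \o fun x => e t * p_ac lam v1 v2 i j t x).
  exact: (integrableZl _ (e t) ip).
have [iA PE] := Rintegral_damped_P_meas i j t A mA Afin.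
have iF : mu.-integrable A (EFin \o fun x =>
    xi * Rintegral mu `[0, t] (fun s => e s * p_ac lam v1 v2 i j s x)).
  exact: (integrableZl _ xi iA).
have ipa : mu.-integrable A (EFin \o fun x => e t * p_ac lam v1 v2 i j t x +
    (if i == j then xi * atom_dens (vel v1 v2 j) t x else 0)).
  exact: (integrableD _ iep iat').
split; first exact: (integrableD _ ipa iF).
rewrite /Pt_meas -/(e t) (damped_P_measE i j t A (ltW t0) mA Afin).
rewrite [X in xi * X]PE {PE}.
rewrite /reset_dens (RintegralD _ ipa iF)// (RintegralD _ iep iat')//.
rewrite (RintegralZl xi _ iA)//.
rewrite mulrDr !addrA; congr (_ + _).
rewrite -!addrA addrCA [RHS]addrCA; congr (_ + _).
case: (i == j).
  by rewrite (RintegralZl xi _ iat)// expr1 mulrAC.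
by rewrite Rintegral_cst// mul0r mulr0.
Qed.

(** * Closed forms of the density and of the flow *)

(** By the alternating sign in [cijE], the sum over [i] cancels the integral of [e * q ^+ 2] and
    keeps [v1 - v2] times that of [e * q], hence only the Gamma term. The difference doubles the
    former integral, which brings in Theta, and puts [v1 + v2] on the latter. *)
Lemma reset_densE (j : nat) (t x : R) : j = 1%N \/ j = 2%N -> 0 < t ->
  v2 * t <= x -> x <= v1 * t ->
  reset_dens 1 j t x + reset_dens 2 j t x = dens_p lam xi v1 v2 j t x /\
  reset_dens 1 j t x - reset_dens 2 j t x = dens_w lam xi v1 v2 j t x.
Proof.
move=> hj t0 xl xr.
have [a a0 [IndE GamE ThE hs]] := strip_entry_time t x t0 xl xr.
have d0 : v1 - v2 != 0 by rewrite gt_eqF// subr_gt0.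
have l0 : lam != 0 by rewrite gt_eqF.
have E0 : expR (xi / lam) != 0 by rewrite gt_eqF// expR_gt0.
have q0 : 1 + lam * t != 0 by rewrite gt_eqF// gcp_rate_gt0// ltW.
(* [dens_w] contains the quotient [x / vel (3 - j)], which [field] has to clear. *)
have w0 := vel_neq0 (3 - j).
have at_p : Num.sg (vel v1 v2 j) * ind_pos v1 v2 j x t *
    (xi * expR (- xi * x / vel v1 v2 j) / (vel v1 v2 j + lam * x)) =
    xi * atom_dens (vel v1 v2 j) t x.
  by rewrite /atom_dens /ind_pos -(mulrA xi) mulrCA.
have at_w : Num.sg (vel v1 v2 j) * (-1) ^+ j.-1 * ind_pos v1 v2 j x t *
    (xi * expR (- xi * x / vel v1 v2 j) / (vel v1 v2 j + lam * x)) =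
    (-1) ^+ j.-1 * (xi * atom_dens (vel v1 v2 j) t x).
  by rewrite -at_p (mulrC _ ((-1) ^+ _)) -!mulrA.
have strip_sum : e t * p_ac lam v1 v2 1 j t x + e t * p_ac lam v1 v2 2 j t x =
    ind_strip v1 v2 x t *
      (expR (- xi * t) * lam / ((v1 - v2) * (1 + lam * t))).
  rewrite !p_acE /ind_strip; case: ifP => _; last by ring.
  rewrite !cijE//; [|by right|by left].
  rewrite /reset_survival /gcp_survival /vel /=.
  by field; rewrite d0 q0.
have strip_diff : e t * p_ac lam v1 v2 1 j t x - e t * p_ac lam v1 v2 2 j t x =
    ind_strip v1 v2 x t *
    (lam * expR (- xi * t) * (lam * (2 * tau v1 v2 x t - t) + (-1) ^+ j)
     / ((v1 - v2) * (1 + lam * t) ^+ 2)).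
  rewrite !p_acE /ind_strip; case: ifP => _; last by ring.
  rewrite !cijE//; [|by right|by left].
  rewrite /reset_survival /gcp_survival /tau.
  by case: hj => ->; rewrite /vel /=; field; rewrite d0 q0.
have [F1 F2] : 
  Rintegral mu `[0, t] (fun s => e s * p_ac lam v1 v2 1 j s x)
  + Rintegral mu `[0, t] (fun s => e s * p_ac lam v1 v2 2 j s x) =
    Ind v1 v2 x t * (expR (xi / lam) / (v1 - v2) * GammaLX lam xi v1 v2 x t) /\
  Rintegral mu `[0, t] (fun s => e s * p_ac lam v1 v2 1 j s x)
  - Rintegral mu `[0, t] (fun s => e s * p_ac lam v1 v2 2 j s x) =
    Ind v1 v2 x t *
    (2 * (vel v1 v2 (3 - j) + lam * x) / (v1 - v2) ^+ 2 * ThetaLX lam xi v1 v2 x t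
     - expR (xi / lam) / (v1 - v2) ^+ 2
       * (2 * vel v1 v2 (3 - j) * xi * (x / vel v1 v2 (3 - j) + 1 / lam) + (v1 + v2))
       * GammaLX lam xi v1 v2 x t).
  rewrite !(Rintegral_damped_p_ac _ _ t x a _ hj a0 hs); [|by right|by left].
  rewrite IndE; case: ifP => at_; last by split; ring.
  (* [expRN] exposes the inverse of [e^(xi / lam)], which cancels the prefactor of Gamma; what
     remains is a rational identity in [I1] and the boundary values. *)
  rewrite GamE GammaInc_survival// ?(ltW at_)// expRN ThE
    (Rintegral_survival_sqr lam xi)//.
  set I1 := Rintegral _ _ _.
  move: w0; set w := vel v1 v2 (3 - j) => w0.
  rewrite /vel /=.
  by split; field; rewrite ?l0 ?d0 ?E0 ?w0.
have -> : reset_dens 1 j t x + reset_dens 2 j t x =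
    (e t * p_ac lam v1 v2 1 j t x + e t * p_ac lam v1 v2 2 j t x)
    + xi * atom_dens (vel v1 v2 j) t x + xi *
    (Rintegral mu `[0, t] (fun s => e s * p_ac lam v1 v2 1 j s x)
  + Rintegral mu `[0, t] (fun s => e s * p_ac lam v1 v2 2 j s x)).
  by rewrite /reset_dens; case: hj => -> /=; ring.
have -> : reset_dens 1 j t x - reset_dens 2 j t x =
    (e t * p_ac lam v1 v2 1 j t x - e t * p_ac lam v1 v2 2 j t x)
    + (-1) ^+ j.-1 * (xi * atom_dens (vel v1 v2 j) t x) + xi *
    (Rintegral mu `[0, t] (fun s => e s * p_ac lam v1 v2 1 j s x)
  - Rintegral mu `[0, t] (fun s => e s * p_ac lam v1 v2 2 j s x)).
  by rewrite /reset_dens; case: hj => -> /=; ring.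
by rewrite F1 F2 strip_sum strip_diff /dens_p /dens_w at_p at_w; split; ring.
Qed.

End process.

(** * Integration of the pointwise identities over a Borel set *)

(** The Dirac term is tested on Borel sets of the closed strip, whose endpoints are the two possible
    positions of the atom. *)
Theorem theorem2 (R : realType) (lam xi v1 v2 : R)
  (hlam : 0 < lam) (hxi : 0 < xi) (hv : v2 < v1)
  (hcase : (v2 < 0 /\ 0 < v1) \/ (0 < v2 /\ v2 < v1))
  (j : nat) (hj : j = 1%N \/ j = 2%N) (t : R) (ht : 0 < t)
  (A : set R) (hA : measurable A) (hAsub : A `<=` `[v2 * t, v1 * t]) :
  Pt_meas lam xi v1 v2 1 j t A + Pt_meas lam xi v1 v2 2 j t A
    = expR (- xi * t) * \1_A (vel v1 v2 j * t) / (1 + lam * t)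
      + Rintegral lebesgue_measure A (dens_p lam xi v1 v2 j t)
  /\
  Pt_meas lam xi v1 v2 1 j t A - Pt_meas lam xi v1 v2 2 j t A
    = (-1) ^+ j.-1 * expR (- xi * t) * \1_A (vel v1 v2 j * t) / (1 + lam * t)
      + Rintegral lebesgue_measure A (dens_w lam xi v1 v2 j t).
Proof.
have [i1 ->] := Pt_measE hlam hxi hv hcase 1 j t A ht hA hAsub.
have [i2 ->] := Pt_measE hlam hxi hv hcase 2 j t A ht hA hAsub.
have densE x : x \in A -> _ := fun xA =>
  let: conj xl xr := andP (hAsub x (set_mem xA)) in
  reset_densE hlam hxi hv hcase j t x hj ht xl xr.
have -> : Rintegral lebesgue_measure A (dens_p lam xi v1 v2 j t) =
    Rintegral lebesgue_measure A (@reset_dens R lam xi v1 v2 1 j t) +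
    Rintegral lebesgue_measure A (@reset_dens R lam xi v1 v2 2 j t).
  rewrite -RintegralD//; apply: eq_Rintegral => x /densE[E _].
  exact/esym/E.
have -> : Rintegral lebesgue_measure A (dens_w lam xi v1 v2 j t) =
    Rintegral lebesgue_measure A (@reset_dens R lam xi v1 v2 1 j t) -
    Rintegral lebesgue_measure A (@reset_dens R lam xi v1 v2 2 j t).
  rewrite -RintegralB//; apply: eq_Rintegral => x /densE[_ E].
  exact/esym/E.
set I1 := Rintegral _ _ _; set I2 := Rintegral _ _ _.
(* Only the sub-density with [i = j] carries the atom, whence the sign [(-1) ^+ j.-1] in the
   difference. *)
by case: hj => ->; rewrite /= /reset_survival; split; ring.
Qed.
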